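(* Let $c(n)$ be a sequence of real numbers with $$c(n) \sim \frac{C}{n^\kappa} \exp\left(\sum_{\lambda\in\mathcal S}A_\lambda n^\lambda \right) \sum_{\mu\in\mathcal T} \frac{\beta_\mu}{n^\mu} \qquad (n \to \infty)$$ (as an asymptotic expansion), where $\kappa\in\mathbb R$, $\mathcal S\subset\mathbb Q^+\cap(0,1)$ is finite, $\mathcal T\subset\mathbb Q_0^+$, and $C, A_\lambda, \beta_\mu\in\mathbb R$ with $\beta_0=1$. Let $\lambda^* := \max\{\lambda\in\mathcal S : A_\lambda\ne 0\}$ and assume that $A_{\lambda^*}>0$. Then, for $n$ sufficiently large, $c(n)$ is log-concave, i.e. $c(n)^2\ge c(n+1)c(n-1)$ for all sufficiently large $n$.
   Context: $\mathbb Q^+$ denotes the positive rationals and $\mathbb Q_0^+$ the non-negative rationals. The displayed relation is meant as an asymptotic expansion: for every $N>0$, $c(n) = \frac{C}{n^\kappa}\exp\bigl(\sum_{\lambda\in\mathcal S}A_\lambda n^\lambda\bigr)\bigl(\sum_{\mu\in\mathcal T,\ \mu<N}\beta_\mu n^{-\mu} + O(n^{-N})\bigr)$ as $n\to\infty$; implicitly $0\in\mathcal T$ and $\mathcal T$ has only finitely many elements below any given bound. *)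

(* Defs.v *)
From HB Require Import structures.
From mathcomp Require Import all_boot all_order all_algebra.
From mathcomp Require Import all_classical all_reals all_analysis.
Set Implicit Arguments.
Unset Strict Implicit.
Unset Printing Implicit Defensive.
Import Order.TTheory GRing.Theory Num.Theory.
Import numFieldNormedType.Exports.
Local Open Scope classical_set_scope.
Local Open Scope ring_scope.

(* Asymptotic expansion in the sense of Poincare: the sum over T is truncated
   below every order N, with an explicit remainder r.  Sums over classical sets
   are the intended ones only when the ranges are finite: S is meant to be
   finite and T to be finite below every bound. *)
Definition has_expansion (R : realType) (c : nat -> R) (C kappa : R)
    (S : set rat) (A : rat -> R) (T : set rat) (beta : rat -> R) : Prop :=
  forall N : R, 0 < N ->
  exists2 r : nat -> R,
    r =O_\oo (fun n : nat => n%:R `^ (- N)) &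
    \forall n \near \oo,
      c n = C / n%:R `^ kappa
            * expR (\sum_(l \in S) A l * n%:R `^ ratr l)
            * (\sum_(mu \in [set mu | T mu /\ ratr mu < N])
                 beta mu / n%:R `^ ratr mu + r n).

Definition eventually_log_concave (R : realType) (c : nat -> R) : Prop :=
  \forall n \near \oo, c n.+1 * c n.-1 <= c n ^+ 2.

(* Main.v *)
Require Import Defs.
From HB Require Import structures.
From mathcomp Require Import all_boot all_order all_algebra.
From mathcomp Require Import all_classical all_reals all_analysis.
From mathcomp Require Import ring lra.
Import Order.TTheory GRing.Theory Num.Theory.
Import numFieldNormedType.Exports.
Local Open Scope classical_set_scope.
Local Open Scope ring_scope.

(** Write Phi x for the sum of the A_l x^l minus kappa ln x, and B n for the
    bracket in the expansion truncated at N = 2, that is B n = G n + r n with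
    G a finite sum of nonpositive powers and r n = O(n^-2).  For n > 0 one has
    c n = C exp(Phi n) B n, so the claim compares

      exp(Phi (n+1) + Phi (n-1)) B (n+1) B (n-1)  with  exp(2 Phi n) (B n)^2,

    and the sign of C is irrelevant since it enters squared on both sides.

    The second difference of a function f at x equals f'' at some point xi
    within distance 1 of x (lemma second_difference_MVT), and xi is comparable
    to x.  Up to constants it is therefore enough to know x^2 f''(x).
    - For Phi this is the sum of the A_l l (l - 1) x^l, plus kappa.  Its
      leading coefficient, at the exponent lambda_star in ]0, 1[, is negative,
      so the expression tends to -oo: for every K the second difference of Phi
      is eventually at most - K / x^2 (lemma near_phase_second_difference).
      This is where 0 < lambda_star < 1 and A lambda_star > 0 are used.
    - For G it is again a sum of nonpositive powers, hence bounded, so the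
      second difference of G is at most M / x^2 (lemma
      near_correction_second_difference); r only contributes another O(n^-2).
    Since B n tends to 1, the arithmetic-geometric mean inequality turns the
    bound on the second difference of B into
    B (n+1) B (n-1) <= (B n)^2 exp(K / n^2) for some K (lemma
    mul_expR_le_sqr), and the concavity of Phi, which beats every K / n^2,
    absorbs the last factor. *)

(** * Second differences as second derivatives *)

(** Two applications of the mean value theorem: first to the increment
    z |-> f (z + 1) - f z between x - 1 and x, whose variation there is the
    second difference, then to f1 between eta and eta + 1. *)
Lemma second_difference_MVT (R : realType) (f f1 f2 : R -> R) (x : R) :
  (forall y : R, x - 1 <= y <= x + 1 -> is_derive y 1 f (f1 y)) ->
  (forall y : R, x - 1 <= y <= x + 1 -> is_derive y 1 f1 (f2 y)) ->
  exists2 xi, x - 1 < xi < x + 1 & f (x + 1) + f (x - 1) - f x *+ 2 = f2 xi.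
Proof.
move=> df df1.
have Dstep y : x - 1 <= y <= x ->
    is_derive y 1 (fun z => f (z + 1) - f z) (f1 (y + 1) - f1 y).
  move=> /andP[ly yr].
  have dfy : is_derive y 1 f (f1 y) by apply: df; lra.
  have dfy1 : is_derive (y + 1) 1 f (f1 (y + 1)) by apply: df; lra.
  have dsh : is_derive y (1 : R) (fun z : R => z + 1) 1.
    by apply: is_derive_eq; rewrite addr0.
  have dcomp := @is_derive1_comp _ f (fun z => z + 1) y _ _ dfy1 dsh.
  by apply: is_derive_eq; rewrite mulr1.
have [|||eta] := @MVT R (fun z => f (z + 1) - f z)
    (fun y => f1 (y + 1) - f1 y) (x - 1) x.
- by lra.
- by move=> y; rewrite in_itv /= => /andP[? ?]; apply: Dstep; lra.
- apply: derivable_within_continuous => y; rewrite in_itv /= => yI.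
  by have [] := Dstep y yI.
rewrite in_itv /= => /andP[le_eta eta_le].
rewrite /= subrK (_ : x - (x - 1) = 1) ?mulr1; last by ring.
move=> step.
have [|||xi] := @MVT R f1 f2 eta (eta + 1).
- by lra.
- by move=> y; rewrite in_itv /= => /andP[? ?]; apply: df1; lra.
- apply: derivable_within_continuous => y; rewrite in_itv /= => /andP[? ?].
  by have [] : is_derive y 1 f1 (f2 y) by apply: df1; lra.
rewrite in_itv /= [eta + 1 - _]addrC addKr mulr1 => /andP[? ?] eq_xi.
exists xi; first by lra.
by rewrite -eq_xi -step; ring.
Qed.

(** For large x the intermediate point is large too, so it inherits every
    property P valid near infinity, and its comparability to x turns a bound of
    order xi^-2 into one of order x^-2. *)
Lemma near_second_difference (R : realType) (f f1 f2 : R -> R) (P : R -> Prop) :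
  (forall y : R, 0 < y -> is_derive y 1 f (f1 y)) ->
  (forall y : R, 0 < y -> is_derive y 1 f1 (f2 y)) ->
  (\forall x \near +oo, P x) ->
  \forall x \near +oo, exists xi, [/\ P xi, x / 2 <= xi <= 2 * x &
    f (x + 1) + f (x - 1) - f x *+ 2 = f2 xi].
Proof.
move=> df df1 [M [_ PM]].
near=> x.
have x2 : 2 < x by near: x; exact: (nbhs_pinfty_gt (num_real _)).
have xM : M + 1 < x by near: x; exact: (nbhs_pinfty_gt (num_real _)).
have [y|y|xi /andP[? ?] ?] := @second_difference_MVT R f f1 f2 x.
- by move=> /andP[? ?]; apply: df; lra.
- by move=> /andP[? ?]; apply: df1; lra.
by exists xi; split=> //; [apply: PM|]; lra.
Unshelve. all: by end_near. Qed.

(** * Finite sums of real powers *)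

Definition power_sum (R : realType) (I : Type) (s : seq I) (a e : I -> R)
  (x : R) : R := \sum_(i <- s) a i * x `^ e i.
Arguments power_sum {R I} s a e x.

Lemma is_derive_power_sum (R : realType) (I : Type) (s : seq I)
    (a e : I -> R) (x : R) : 0 < x ->
  is_derive x 1 (power_sum s a e)
    (power_sum s (fun i => a i * e i) (fun i => e i - 1) x).
Proof.
move=> x0; rewrite /power_sum; elim: s => [|i s IH].
  have -> : (fun y : R => \sum_(i <- [::]) a i * y `^ e i) = cst 0.
    by apply/funext => y; rewrite big_nil.
  by rewrite big_nil; exact: is_derive_cst.
have -> : (fun y : R => \sum_(j <- i :: s) a j * y `^ e j) =
    a i *: (powR (R:=R))^~ (e i) + (fun y => \sum_(j <- s) a j * y `^ e j).
  by apply/funext => y; rewrite big_cons.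
rewrite big_cons -mulrA.
have dpow := is_derive1_powR (e i) x0.
exact: is_deriveD.
Qed.

Lemma sqr_mul_powR_sub2 (R : realType) (x e : R) : 0 < x ->
  x ^+ 2 * x `^ (e - 1 - 1) = x `^ e.
Proof.
move=> x0; rewrite -powR_mulrn ?ltW// -powRD; first by congr (_ `^ _); ring.
by apply/implyP => _; rewrite gt_eqF.
Qed.

(** Differentiating twice lowers all exponents by 2; the factor x^2 restores
    them, which brings the second derivative back to a sum with the original
    exponents. *)
Lemma sqr_mul_power_sum (R : realType) (I : Type) (s : seq I) (a e : I -> R)
    (x : R) : 0 < x ->
  x ^+ 2 * power_sum s a (fun i => e i - 1 - 1) x = power_sum s a e x.
Proof.
move=> x0; rewrite /power_sum big_distrr /=; apply: eq_bigr => i _.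
by rewrite mulrCA sqr_mul_powR_sub2.
Qed.

Lemma near_powR_gt (R : realType) (e M : R) : 0 < e ->
  \forall x \near +oo, M < x `^ e.
Proof.
move=> e0; near=> x.
have M0 : 0 <= Num.max M 0 by rewrite le_max lexx orbT.
have xM : (Num.max M 0) `^ e^-1 < x.
  by near: x; exact: (nbhs_pinfty_gt (num_real _)).
have x0 : 0 <= x by rewrite (le_trans _ (ltW xM))// powR_ge0.
apply: (@le_lt_trans _ _ (((Num.max M 0) `^ e^-1) `^ e)).
  by rewrite -powRrM mulVf ?gt_eqF// powRr1// le_max lexx.
by apply: gt0_ltr_powR; rewrite // ?nnegrE ?powR_ge0.
Unshelve. all: by end_near. Qed.

(** Powers below E are negligible against x^E.  Each term of the list is given
    half of the tolerance left over by the terms before it. *)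
Lemma near_sum_abs_powR_le (R : realType) (I : eqType) (s : seq I) (P : pred I)
    (a e : I -> R) (E eps : R) : 0 < eps ->
  (forall i, i \in s -> P i -> a i != 0 -> e i < E) ->
  \forall x \near +oo, \sum_(i <- s | P i) `|a i| * x `^ e i <= eps * x `^ E.
Proof.
elim: s eps => [|i s IH] eps eps0 lt_eE.
  by near=> x; rewrite big_nil mulr_ge0 ?powR_ge0// ltW.
have eps20 : 0 < eps / 2 by rewrite divr_gt0.
have tail : \forall x \near +oo,
    \sum_(j <- s | P j) `|a j| * x `^ e j <= eps / 2 * x `^ E.
  by apply: IH => // j js; apply: lt_eE; rewrite inE js orbT.
have head : \forall x \near +oo, P i -> `|a i| * x `^ e i <= eps / 2 * x `^ E.
  have [Pi|] := boolP (P i); last by move=> _; apply: nearW.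
  have [->|ai0] := eqVneq (a i) 0.
    by near=> x => _; rewrite normr0 mul0r mulr_ge0 ?powR_ge0// ltW.
  have gap : 0 < E - e i by rewrite subr_gt0 lt_eE ?mem_head.
  near=> x => _.
  have x0 : 0 < x by near: x; exact: (nbhs_pinfty_gt (num_real _)).
  have big : `|a i| / (eps / 2) < x `^ (E - e i).
    by near: x; exact: near_powR_gt.
  have -> : x `^ E = x `^ (E - e i) * x `^ e i.
    by rewrite -powRD ?subrK// (gt_eqF x0) implybT.
  rewrite mulrA; apply: ler_wpM2r; first exact: powR_ge0.
  by rewrite mulrC -ler_pdivrMr// ltW.
near=> x; rewrite big_cons.
have tx : \sum_(j <- s | P j) `|a j| * x `^ e j <= eps / 2 * x `^ E.
  by near: x; exact: tail.
have hx : P i -> `|a i| * x `^ e i <= eps / 2 * x `^ E by near: x; exact: head.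
rewrite [eps]splitr mulrDl; case: ifP => [/hx hx'|_]; first exact: lerD.
by rewrite (le_trans tx)// lerDr mulr_ge0 ?powR_ge0// ltW.
Unshelve. all: by end_near. Qed.

(** Terms with zero coefficient may carry larger exponents, as S may contain
    exponents above lambda_star at which A vanishes. *)
Lemma near_power_sum_leading (R : realType) (I : eqType) (s : seq I)
    (a e : I -> R) (i0 : I) (eps : R) : 0 < eps -> uniq s -> i0 \in s ->
  (forall i, i \in s -> i != i0 -> a i != 0 -> e i < e i0) ->
  \forall x \near +oo,
    `|power_sum s a e x - a i0 * x `^ e i0| <= eps * x `^ e i0.
Proof.
move=> eps0 us si0 lead.
have rest := @near_sum_abs_powR_le R I s (fun i => i != i0) a e _ _ eps0 lead.
near=> x.
rewrite /power_sum (bigD1_seq i0)//= addrAC subrr add0r.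
apply: le_trans (ler_norm_sum _ _ _) _.
under eq_bigr do rewrite normrM (ger0_norm (powR_ge0 _ _)).
by near: x; exact: rest.
Unshelve. all: by end_near. Qed.

Lemma power_sum_norm_le (R : realType) (I : eqType) (s : seq I)
    (a e : I -> R) (x : R) : 1 <= x -> (forall i, i \in s -> e i <= 0) ->
  `|power_sum s a e x| <= \sum_(i <- s) `|a i|.
Proof.
move=> x1 e0; apply: le_trans (ler_norm_sum _ _ _) _.
rewrite [leLHS]big_seq [leRHS]big_seq; apply: ler_sum => i si.
rewrite normrM (ger0_norm (powR_ge0 _ _)) ler_piMr//.
by rewrite -(powRr0 x) ler_powR// e0.
Qed.

(** * Second differences of the two factors *)

(** The strict concavity of the exponent, in the only form that matters: it
    dominates every multiple of x^-2.  Multiplied by x^2, the second derivative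
    is a power sum with negative leading coefficient a i0 * e i0 * (e i0 - 1)
    and positive leading exponent, plus the constant kappa coming from the
    logarithm. *)
Lemma near_phase_second_difference (R : realType) (I : eqType) (s : seq I)
    (a e : I -> R) (i0 : I) (kappa K : R) :
  uniq s -> i0 \in s -> 0 < a i0 -> 0 < e i0 < 1 ->
  (forall i, i \in s -> i != i0 -> a i != 0 -> e i < e i0) -> 0 <= K ->
  let phase x := power_sum s a e x - kappa * ln x in
  \forall x \near +oo,
    phase (x + 1) + phase (x - 1) - phase x *+ 2 <= - (K / x ^+ 2).
Proof.
move=> us si0 a0 /andP[e0 e1] lead K0 phase.
(* Writing the derivative 1 / x of ln as a power lets the rule for powers give
   the second derivative as well. *)
pose phase1 (x : R) := power_sum s (fun i => a i * e i) (fun i => e i - 1) x -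
  kappa * x `^ (- 1).
pose a2 i := a i * e i * (e i - 1).
pose phase2 (x : R) := power_sum s a2 (fun i => e i - 1 - 1) x -
  kappa * (- 1 * x `^ (- 1 - 1)).
have d1 (y : R) : 0 < y -> is_derive y 1 phase (phase1 y).
  move=> y0; rewrite /phase /phase1.
  have dp := @is_derive_power_sum R I s a e y y0.
  have dl : is_derive y 1 (kappa *: @ln R) (kappa * y `^ (- 1)).
    by have := is_derive1_ln y0 => dln; rewrite powR_inv1 ?ltW//;
       apply: is_deriveZ.
  exact: is_deriveB.
have d2 (y : R) : 0 < y -> is_derive y 1 phase1 (phase2 y).
  move=> y0; rewrite /phase1 /phase2.
  have dp := @is_derive_power_sum R I s (fun i => a i * e i)
    (fun i => e i - 1) y y0.
  have dl : is_derive y 1 (kappa *: (powR (R:=R))^~ (- 1))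
      (kappa * (- 1 * y `^ (- 1 - 1))).
    by have := is_derive1_powR (- 1) y0 => dpow; apply: is_deriveZ.
  exact: is_deriveB.
have a2neg : a2 i0 < 0 by rewrite pmulr_rlt0 ?mulr_gt0// subr_lt0.
have lead2 i : i \in s -> i != i0 -> a2 i != 0 -> e i < e i0.
  move=> si ii0 a2i; apply: lead => //.
  by apply: contraNneq a2i => ai; rewrite /a2 ai !mul0r.
have eps0 : 0 < - a2 i0 / 2 by lra.
(* The factor 4 makes up for xi <= 2 x when passing from xi to x. *)
have concave : \forall x \near +oo, 0 < x /\ x ^+ 2 * phase2 x <= - (4 * K).
  have dom := @near_power_sum_leading R I s a2 e i0 _ eps0 us si0 lead2.
  near=> x.
  have x0 : 0 < x by near: x; exact: (nbhs_pinfty_gt (num_real _)).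
  split => //.
  rewrite /phase2 mulrBr sqr_mul_power_sum// mulN1r mulrN mulrN opprK.
  rewrite mulrCA (_ : x ^+ 2 * _ = 1) ?mulr1; last first.
    by have := sqr_mul_powR_sub2 _ _ 0 x0; rewrite sub0r powRr0.
  have : `|power_sum s a2 e x - a2 i0 * x `^ e i0| <= - a2 i0 / 2 * x `^ e i0.
    by near: x; exact: dom.
  have : (4 * K + kappa) / (- a2 i0 / 2) < x `^ e i0.
    by near: x; exact: near_powR_gt.
  by rewrite ltr_pdivrMr// => big /(le_trans (ler_norm _)); lra.
have near_eq := near_second_difference R phase phase1 phase2 _ d1 d2 concave.
near=> x.
have x0 : 0 < x by near: x; exact: (nbhs_pinfty_gt (num_real _)).
have [xi [[xi0 small] /andP[_ xi2] ->]] : exists xi,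
    [/\ 0 < xi /\ xi ^+ 2 * phase2 xi <= - (4 * K), x / 2 <= xi <= 2 * x &
    phase (x + 1) + phase (x - 1) - phase x *+ 2 = phase2 xi].
  by near: x; exact: near_eq.
rewrite -mulNr ler_pdivlMr ?exprn_gt0//.
(* Since xi may be smaller than 2 x, replacing xi by 2 x needs this sign. *)
have neg : phase2 xi <= 0.
  by rewrite -(pmulr_rle0 _ (exprn_gt0 2 xi0)) (le_trans small)//; lra.
have sq : xi ^+ 2 <= 4 * x ^+ 2 by nra.
nra.
Unshelve. all: by end_near. Qed.

(** With nonpositive exponents, x^2 times the second derivative is bounded by
    the sum of the absolute values of its coefficients as soon as x >= 1. *)
Lemma near_correction_second_difference (R : realType) (I : eqType) (s : seq I)
    (b e : I -> R) : (forall i, i \in s -> e i <= 0) ->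
  exists2 M : R, 0 <= M & \forall x \near +oo,
    power_sum s b e (x + 1) + power_sum s b e (x - 1) - power_sum s b e x *+ 2
      <= M / x ^+ 2.
Proof.
move=> e0.
pose b2 i := b i * e i * (e i - 1).
pose M := \sum_(i <- s) `|b2 i|.
have M0 : 0 <= M by rewrite sumr_ge0.
exists (4 * M); first by lra.
have d1 (y : R) (y0 : 0 < y) := @is_derive_power_sum R I s b e y y0.
have d2 (y : R) (y0 : 0 < y) := @is_derive_power_sum R I s
  (fun i => b i * e i) (fun i => e i - 1) y y0.
have ge1 : \forall x \near +oo, (1 : R) < x.
  exact: (nbhs_pinfty_gt (num_real _)).
have near_eq := near_second_difference R _ _ _ _ d1 d2 ge1.
near=> x.
have x0 : 0 < x by near: x; exact: (nbhs_pinfty_gt (num_real _)).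
have [xi [xi1 /andP[xi2 _] ->]] : exists xi,
    [/\ 1 < xi, x / 2 <= xi <= 2 * x &
    power_sum s b e (x + 1) + power_sum s b e (x - 1) - power_sum s b e x *+ 2
    = power_sum s b2 (fun i => e i - 1 - 1) xi].
  by near: x; exact: near_eq.
have xi0 : 0 < xi by lra.
rewrite ler_pdivlMr ?exprn_gt0//.
set g := power_sum _ _ _ _.
have gM : xi ^+ 2 * g <= M.
  rewrite sqr_mul_power_sum// (le_trans (ler_norm _))// power_sum_norm_le//.
  exact: ltW.
(* Here M >= 0, so only a positive g has to be controlled by xi >= x / 2. *)
have [g0|g0] := leP g 0; first by rewrite (@le_trans _ _ 0)//; nra.
have sq : x ^+ 2 <= 4 * xi ^+ 2 by nra.
nra.
Unshelve. all: by end_near. Qed.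

(** * Combining the factors *)

(** If the exponents are concave by t and the factors b convex by at most
    t / 2, then the mean of b1 and b2 is at most b0 + t / 4, which is at most
    b0 * (1 + t / 2) because b0 >= 1 / 2; so
    b1 * b2 <= b0^2 (1 + t / 2)^2 <= b0^2 exp t, and exp (- t) from the
    exponents compensates. *)
Lemma mul_expR_le_sqr (R : realType) (p0 p1 p2 b0 b1 b2 t : R) :
  p1 + p2 - p0 *+ 2 <= - t -> b1 + b2 - b0 *+ 2 <= t / 2 ->
  0 <= t -> 1 / 2 <= b0 -> 0 <= b1 -> 0 <= b2 ->
  (expR p1 * b1) * (expR p2 * b2) <= (expR p0 * b0) ^+ 2.
Proof.
move=> pt bt t0 b0h b10 b20.
have bb : b1 * b2 <= expR t * b0 ^+ 2.
  have amgm : b1 * b2 <= (b0 * (1 + t / 2)) ^+ 2.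
    have mean : (b1 + b2) / 2 <= b0 * (1 + t / 2) by nra.
    apply: (@le_trans _ _ (((b1 + b2) / 2) ^+ 2)).
      by have := sqr_ge0 (b1 - b2); lra.
    by apply: lerXn2r; rewrite ?nnegrE//; lra.
  apply: (le_trans amgm); rewrite exprMn mulrC ler_wpM2r ?sqr_ge0//.
  rewrite [t in expR t]splitr expRD -expr2; apply: lerXn2r;
    rewrite ?nnegrE ?expR_ge0 ?expR_ge1Dx//.
  by lra.
rewrite mulrACA -expRD exprMn -expRM_natl.
apply: (@le_trans _ _ (expR (p1 + p2) * (expR t * b0 ^+ 2))).
  by rewrite ler_wpM2l ?expR_ge0.
rewrite mulrA -expRD ler_wpM2r ?sqr_ge0// ler_expR; lra.
Qed.

Lemma near_neighbours (P : nat -> Prop) : (\forall n \near \oo, P n) ->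
  \forall n \near \oo, [/\ P n, P n.+1 & P n.-1].
Proof.
case=> N _ PN; exists N.+1 => // n /= Nn; split; apply: PN => /=.
- exact: ltnW.
- exact/ltnW/leqW.
- by case: n Nn.
Qed.

Lemma near_nat_of_near_pinfty (R : realType) (P : R -> Prop) :
  (\forall x \near +oo, P x) -> \forall n \near \oo, P n%:R.
Proof. by move=> Px; exact: (@cvgr_idn R _ Px). Qed.

Theorem theorem1p3 (R : realType) (c : nat -> R) (C kappa : R)
    (S : set rat) (A : rat -> R) (T : set rat) (beta : rat -> R)
    (lambda_star : rat)
    (S_finite : finite_set S)
    (S_sub : forall l : rat, S l -> 0 < l < 1)
    (T_sub : forall mu : rat, T mu -> 0 <= mu)
    (T_locally_finite : forall b : R, finite_set [set mu | T mu /\ ratr mu < b])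
    (T0 : T 0)
    (beta0 : beta 0 = 1)
    (c_expansion : has_expansion c C kappa S A T beta)
    (lambda_star_mem : S lambda_star /\ A lambda_star != 0)
    (lambda_star_max :
       forall l : rat, S l -> A l != 0 -> l <= lambda_star)
    (A_lambda_star_pos : 0 < A lambda_star) :
  eventually_log_concave c.
Proof.
(* The order N = 2 suffices: a remainder O(n^-2) is of the same order as the
   second difference of the retained terms. *)
have [|r /eqO_exP[k k0 r_le] c_eq] := c_expansion 2; first by [].
pose sS : seq rat := finmap.enum_fset (fset_set S).
pose T2 := [set mu | T mu /\ ratr mu < 2 :> R].
pose sT : seq rat := finmap.enum_fset (fset_set T2).
have memS l : l \in sS -> S l by rewrite /sS in_fset_set// => /set_mem.
have memT mu : mu \in sT -> T mu.
  by rewrite /sT in_fset_set; [move=> /set_mem[]|exact: T_locally_finite].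
pose phase x := power_sum sS A ratr x - kappa * ln x.
pose G := power_sum sT beta (fun mu => - ratr mu).
pose B n := G n%:R + r n.
have c_form : \forall n \near \oo, c n = C * (expR (phase n%:R) * B n).
  near=> n.
  have n0 : (0 < n)%N by near: n; exact: nbhs_infty_gt.
  have -> : c n = C / n%:R `^ kappa
            * expR (\sum_(l \in S) A l * n%:R `^ ratr l)
            * (\sum_(mu \in T2) beta mu / n%:R `^ ratr mu + r n).
    by near: n.
  rewrite !fsbig_finite//=; last exact: T_locally_finite.
  rewrite /phase expRD expRN {1}/powR pnatr_eq0 gtn_eqF//.
  rewrite [X in _ = C * (X * _)]mulrC !mulrA; congr (_ * (_ + _)).
  by apply: eq_bigr => mu _; rewrite powRN.
have r_small : \forall n \near \oo, `|r n| <= k / n%:R ^+ 2.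
  near=> n.
  have : `|r n| <= k * `|n%:R `^ (- 2)| by near: n; exact: r_le.
  by rewrite powRN normfV (ger0_norm (powR_ge0 _ _)) powR_mulrn.
have G_large : \forall x \near +oo, 3 / 4 <= G x.
  have sT0 : 0 \in sT.
    rewrite /sT in_fset_set; last exact: T_locally_finite.
    by apply/mem_set; split; rewrite ?raddf0.
  have lead mu : mu \in sT -> mu != 0 -> beta mu != 0 ->
      - ratr mu < - ratr 0 :> R.
    move=> /memT/T_sub mu_ge0 mu_neq0 _.
    by rewrite ltrN2 ltr_rat lt_neqAle eq_sym mu_neq0.
  have quarter : 0 < 1 / 4 :> R by lra.
  have dom := @near_power_sum_leading R rat sT beta (fun mu => - ratr mu) 0 _
    quarter (finmap.fset_uniq _) sT0 lead.
  near=> x.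
  have : `|G x - beta 0 * x `^ (- ratr 0)| <= 1 / 4 * x `^ (- ratr 0).
    by near: x; exact: dom.
  by rewrite beta0 raddf0 oppr0 powRr0 ler_norml => /andP[? _]; lra.
have B_large : \forall n \near \oo, 1 / 2 <= B n.
  near=> n.
  have Gn : 3 / 4 <= G n%:R.
    by near: n; exact: (near_nat_of_near_pinfty _ _ G_large).
  have rn : `|r n| <= k / n%:R ^+ 2 by near: n; exact: r_small.
  have n1 : 1 < n%:R :> R.
    by near: n; exact: nbhs_infty_gtr.
  have nk : 4 * k < n%:R.
    by near: n; exact: nbhs_infty_gtr.
  have : k / n%:R ^+ 2 <= 1 / 4 by rewrite ler_pdivrMr ?exprn_gt0//; nra.
  by move: rn; rewrite /B ler_norml => /andP[? _] ?; lra.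
have [M M0 G2] : exists2 M : R, 0 <= M & \forall x \near +oo,
    G (x + 1) + G (x - 1) - G x *+ 2 <= M / x ^+ 2.
  apply: near_correction_second_difference => mu /memT/T_sub mu0.
  by rewrite oppr_le0 ler0q.
(* The remainder contributes at most k (4 + 4 + 2) / n^2 to the second
   difference of B, as r (n + 1) and r (n - 1) are bounded by 4 k / n^2; the
   factor 2 is the t / 2 in mul_expR_le_sqr. *)
pose K := 2 * (M + 10 * k).
have phase2 : \forall x \near +oo,
    phase (x + 1) + phase (x - 1) - phase x *+ 2 <= - (K / x ^+ 2).
  have [Sl _] := lambda_star_mem.
  apply: (@near_phase_second_difference R rat sS A ratr lambda_star) => //.
  - exact: finmap.fset_uniq.
  - by rewrite /sS in_fset_set//; exact: mem_set.
  - by rewrite -(rmorph0 (@ratr R)) -(rmorph1 (@ratr R)) !ltr_rat S_sub.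
  - move=> l /memS Sl' l_neq Al.
    by rewrite ltr_rat lt_neqAle l_neq lambda_star_max.
  - by rewrite /K; lra.
pose Q n := c n = C * (expR (phase n%:R) * B n) /\
  (`|r n| <= k / n%:R ^+ 2 /\ 1 / 2 <= B n).
have nearQ : \forall n \near \oo, Q n.
  exact: (filterI c_form (filterI r_small B_large)).
near=> n.
have [] : [/\ Q n, Q n.+1 & Q n.-1] by near: n; exact: near_neighbours.
move=> [cn [rn Bn]] [cn1 [rn1 Bn1]] [cn' [rn' Bn']].
have n2 : 2 < n%:R :> R.
  by near: n; exact: nbhs_infty_gtr.
have n0 : (0 < n)%N by rewrite -(ltr0n R); lra.
have succE : n.+1%:R = n%:R + 1 :> R by rewrite -natr1.
have predE : n.-1%:R = n%:R - 1 :> R.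
  by rewrite -[in RHS](prednK n0) -natr1 addrK.
have phase2n : phase (n%:R + 1) + phase (n%:R - 1) - phase n%:R *+ 2
    <= - (K / n%:R ^+ 2).
  by near: n; exact: (near_nat_of_near_pinfty _ _ phase2).
have G2n : G (n%:R + 1) + G (n%:R - 1) - G n%:R *+ 2 <= M / n%:R ^+ 2.
  by near: n; exact: (near_nat_of_near_pinfty _ _ G2).
rewrite cn cn1 cn' [_ ^+ 2]exprMn mulrACA -expr2 ler_wpM2l ?sqr_ge0//.
apply: (@mul_expR_le_sqr _ _ _ _ _ _ _ (K / n%:R ^+ 2)).
- by rewrite succE predE; exact: phase2n.
- have inv_le (m : R) : 1 / 2 * n%:R <= m -> k / m ^+ 2 <= 4 * k / n%:R ^+ 2.
    move=> nm; have m0 : 0 < m by lra.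
    have nR0 : 0 < n%:R :> R by lra.
    have sq : n%:R ^+ 2 <= 4 * m ^+ 2 by nra.
    rewrite ler_pdivrMr ?exprn_gt0// mulrAC ler_pdivlMr ?exprn_gt0//.
    by rewrite [4 * k]mulrC -mulrA ler_wpM2l// ltW.
  have r1 : `|r n.+1| <= 4 * k / n%:R ^+ 2.
    by apply: (le_trans rn1); apply: inv_le; rewrite succE; lra.
  have r2 : `|r n.-1| <= 4 * k / n%:R ^+ 2.
    by apply: (le_trans rn'); apply: inv_le; rewrite predE; lra.
  move: rn r1 r2 G2n; rewrite /B /K succE predE !ler_norml.
  move=> /andP[? ?] /andP[? ?] /andP[? ?] ?; lra.
- by rewrite divr_ge0 ?sqr_ge0// /K; lra.
- exact: Bn.
- by lra.
- by lra.
Unshelve. all: by end_near. Qed.
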